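(* The Lie subalgebra $\mathfrak{L}(q)$ of $\mathcal{H}(q)$ generated by $A,B$ is precisely $\mathfrak{L}_0(q)$; that is, $\mathfrak{L}(q)=\mathfrak{L}_0(q)$.
   Context: Fix a real number $q$ with $0<q<1$. Let $\mathbb{N}=\{0,1,2,\ldots\}$, let $\mathbb{Z}^+$ be the set of positive integers, and $\{n\}_q:=1+q+\cdots+q^{n-1}=\frac{1-q^n}{1-q}$ (so $\{0\}_q=0$). Let $\mathfrak{H}$ be an infinite-dimensional separable complex Hilbert space with a complete orthonormal basis $\{\Phi_n : n\in\mathbb{N}\}$, and let $\mathfrak{B}(\mathfrak{H})$ be the algebra of bounded linear operators on $\mathfrak{H}$. Let $A,B\in\mathfrak{B}(\mathfrak{H})$ be the bounded operators determined by $B\Phi_n=\sqrt{\{n+1\}_q}\,\Phi_{n+1}$ for $n\ge 0$, $A\Phi_n=\sqrt{\{n\}_q}\,\Phi_{n-1}$ for $n\geq 1$, and $A\Phi_0=0$. They satisfy $AB-qBA=I$. Let $\mathcal{H}(q)$ denote the unital subalgebra of $\mathfrak{B}(\mathfrak{H})$ generated by $A,B$ (no topological closure is taken; it is a faithful copy of the abstract $q$-deformed Heisenberg algebra generated by $A,B$ subject to $AB-qBA=I$). $\mathcal{H}(q)$ is a Lie algebra over $\mathbb{C}$ under $[f,g]:=fg-gf$. A Lie subalgebra is a linear subspace closed under this bracket, and $\mathfrak{L}(q)$ is the smallest Lie subalgebra of $\mathcal{H}(q)$ containing $A$ and $B$ (its elements are called Lie polynomials in $A,B$). $\mathfrak{L}_0(q)$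 is the linear span of the elements $A$, $B$, $[A,B]^k$, $[A,B]^kA^l$, $B^l[A,B]^k$ with $k,l\in\mathbb{Z}^+$, where $[A,B]^k$ denotes the $k$-th power of the operator $[A,B]=AB-BA$. *)

(* Defs.v *)
From HB Require Import structures.
From mathcomp Require Import all_boot all_order all_algebra sesquilinear.
From mathcomp Require Import complex.
From mathcomp Require Import all_classical all_reals all_analysis.

Set Implicit Arguments.
Unset Strict Implicit.
Unset Printing Implicit Defensive.

Import Order.TTheory GRing.Theory Num.Theory Num.Def.
Import numFieldNormedType.Exports.

Local Open Scope classical_set_scope.
Local Open Scope ring_scope.

Definition qint (R : realType) (q : R) (n : nat) : R := \sum_(i < n) q ^+ i.

Definition span (K : numFieldType) (V : lmodType K) (X : set V) : set V :=
  [set x | exists (n : nat) (c : 'I_n -> K) (v : 'I_n -> V),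
     (forall i, X (v i)) /\ x = \sum_(i < n) c i *: v i].

(* [dot] is the inner product (linear in its first argument). *)
Definition complete_orthonormal_basis (C : numClosedFieldType)
    (H : normedModType C) (dot : {dot H for conjC}) (Phi : nat -> H) : Prop :=
  (forall m n, dot (Phi m) (Phi n) = (m == n)%:R) /\
  closure (span (range Phi)) = setT.

Section BoundedOp.
Variables (K : numFieldType) (V : normedModType K).

Definition bounded_operator : {pred V -> V} := [in [set f : V -> V |
  linear f /\ exists2 M : K, 0 <= M & forall x, `|f x| <= M * `|x|]].

Record boundedOp := BoundedOp {
  boundedOp_fun :> V -> V;
  boundedOpP : boundedOp_fun \in bounded_operator }.

HB.instance Definition _ := [isSub for boundedOp_fun].
HB.instance Definition _ := [Choice of boundedOp by <:].

Lemma bounded_operatorP (f : V -> V) : f \in bounded_operator <->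
  linear f /\ exists2 M : K, 0 <= M & forall x, `|f x| <= M * `|x|.
Proof. by split; [move/set_mem|move=> h; apply/mem_set]. Qed.

Fact bounded_operator_submod_closed : GRing.submod_closed bounded_operator.
Proof.
split.
  apply/bounded_operatorP; split=> [a x y|]; first by rewrite /= scaler0 addr0.
  by exists 0 => // x; rewrite normr0 mul0r.
move=> a f g /bounded_operatorP[fl [M M0 fM]] /bounded_operatorP[gl [N N0 gN]].
apply/bounded_operatorP; split=> [b x y|].
  rewrite /= !fctE fl gl !scalerDr !scalerA addrACA; congr (_ + _ + _).
  by rewrite mulrC.
exists (`|a| * M + N); first by rewrite addr_ge0 ?mulr_ge0.
move=> x; rewrite !fctE (le_trans (ler_normD _ _))// mulrDl lerD// normrZ.
by rewrite -mulrA ler_wpM2l.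
Qed.

HB.instance Definition _ := GRing.isSubmodClosed.Build K (V -> V)
  bounded_operator (GRing.submod_closed_semi bounded_operator_submod_closed).

HB.instance Definition _ := [SubChoice_isSubLmodule of boundedOp by <:].

Lemma boundedOp_ext (f g : boundedOp) : f =1 g -> f = g.
Proof. by move=> fg; apply/val_inj/funext. Qed.

Fact id_bounded_operator : idfun \in bounded_operator.
Proof.
by apply/bounded_operatorP; split=> //; exists 1 => // x; rewrite mul1r.
Qed.

Fact comp_bounded_operator (f g : boundedOp) : f \o g \in bounded_operator.
Proof.
have /bounded_operatorP[fl [M M0 fM]] := boundedOpP f.
have /bounded_operatorP[gl [N N0 gN]] := boundedOpP g.
apply/bounded_operatorP; split=> [a x y|]; first by rewrite /= gl fl.
exists (M * N); first exact: mulr_ge0.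
by move=> x /=; rewrite (le_trans (fM _))// -mulrA ler_wpM2l.
Qed.

Definition boundedOp1 := BoundedOp id_bounded_operator.
Definition boundedOp_mul f g := BoundedOp (comp_bounded_operator f g).

Fact boundedOp_mulA : associative boundedOp_mul.
Proof. by move=> f g h; apply: boundedOp_ext. Qed.

Fact boundedOp_mul1l : left_id boundedOp1 boundedOp_mul.
Proof. by move=> f; apply: boundedOp_ext. Qed.

Fact boundedOp_mul1r : right_id boundedOp1 boundedOp_mul.
Proof. by move=> f; apply: boundedOp_ext. Qed.

Fact boundedOp_mulDl : left_distributive boundedOp_mul +%R.
Proof. by move=> f g h; apply: boundedOp_ext. Qed.

Fact boundedOp_mulDr : right_distributive boundedOp_mul +%R.
Proof.
move=> f g h; apply: boundedOp_ext => x /=.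
have /bounded_operatorP[fl _] := boundedOpP f.
by have := fl 1 (g x) (h x); rewrite !scale1r.
Qed.

HB.instance Definition _ := GRing.Zmodule_isPzRing.Build boundedOp
  boundedOp_mulA boundedOp_mul1l boundedOp_mul1r
  boundedOp_mulDl boundedOp_mulDr.

(* This unfolds [GRing.subalg_closed], which is not available here because
   [lalgType] requires [1 != 0], i.e. a nonzero space. *)
Definition unital_subalgebra (S : set boundedOp) : Prop :=
  [/\ 1 \in S, GRing.linear_closed [in S] & GRing.mulr_2closed [in S]].

Definition generated_subalgebra (X : set boundedOp) : set boundedOp :=
  smallest unital_subalgebra X.

Definition lie (f g : boundedOp) : boundedOp := f * g - g * f.

Definition lie_subalgebra (L S : set boundedOp) : Prop :=
  [/\ S `<=` L, GRing.submod_closed [in S]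
    & forall f g, S f -> S g -> S (lie f g)].

Definition generated_lie_subalgebra (L X : set boundedOp) : set boundedOp :=
  smallest (lie_subalgebra L) X.

Definition lie_polynomials (A B : boundedOp) : set boundedOp :=
  generated_lie_subalgebra (generated_subalgebra [set A; B]) [set A; B].

Definition L0_generators (A B : boundedOp) : set boundedOp :=
  [set f | [\/ f = A, f = B | exists k l : nat, [/\ (0 < k)%N, (0 < l)%N &
     [\/ f = lie A B ^+ k,
         f = lie A B ^+ k * A ^+ l
       | f = B ^+ l * lie A B ^+ k]]]].

Definition L0 (A B : boundedOp) : set boundedOp := span (L0_generators A B).

End BoundedOp.

(* Main.v *)
(* Write [C] for [[A, B]].  From [A B - q B A = 1] one gets [A C = q C A],
   [C B = q B C], [(1 - q) B A = 1 - C] and [(1 - q) A B = 1 - q C], so the span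
   [I] of the [C^k A^l] and [B^l C^k] with [k > 0], [l >= 0] is a two-sided ideal
   of [H(q)]; since [L0 = <A, B> + I] and [[A, B] = C] lies in [I], all brackets
   of elements of [L0] lie in [I], hence in [L0].
   Conversely [[C^k A^l, A] = (1 - q^k) C^k A^(l+1)],
   [[B, B^l C^k] = (1 - q^k) B^(l+1) C^k], and [[C^k A, B]] is a combination of
   [C^k] and [C^(k+1)] in which [C^(k+1)] has the nonzero coefficient
   [(q^-k - q) / (1 - q)], so every generator of [L0] is a Lie polynomial. *)

From HB Require Import structures.
Require Import Defs.
From mathcomp Require Import all_boot all_order all_algebra sesquilinear.
From mathcomp Require Import complex.
From mathcomp Require Import all_classical all_reals all_analysis.

Set Implicit Arguments.
Unset Strict Implicit.
Unset Printing Implicit Defensive.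

Import Order.TTheory GRing.Theory Num.Theory Num.Def.
Import numFieldNormedType.Exports.

Local Open Scope classical_set_scope.
Local Open Scope ring_scope.
Local Open Scope complex_scope.

(* [all_algebra] shadows [span] by the span of a sequence. *)
Local Notation span := Defs.span.

Section Span.
Variables (K : numFieldType) (V : lmodType K).
Implicit Types (X S : set V) (u v : V).

Lemma submod_closedP S : GRing.submod_closed [in S] <->
  [/\ S 0, forall u v, S u -> S v -> S (u + v) & forall a u, S u -> S (a *: u)].
Proof.
split=> [[/set_mem S0 SL]|[S0 SD SZ]].
  have SZD a u v : S u -> S v -> S (a *: u + v).
    by move=> Su Sv; apply/set_mem/SL; apply/mem_set.
  split=> // [u v Su Sv|a u Su]; first by rewrite -[u]scale1r; exact: SZD.
  by rewrite -[_ *: _]addr0; exact: SZD.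
split; first exact/mem_set.
by move=> a u v /set_mem Su /set_mem Sv; apply/mem_set/SD => //; exact: SZ.
Qed.

Lemma submod_closedB S u v : GRing.submod_closed [in S] ->
  S u -> S v -> S (u - v).
Proof.
move=> /submod_closedP[_ SD SZ] Su Sv.
by rewrite -scaleN1r; apply: SD => //; exact: SZ.
Qed.

Lemma submod_closed_scaleI S a u : GRing.submod_closed [in S] ->
  a != 0 -> S (a *: u) -> S u.
Proof.
move=> /submod_closedP[_ _ SZ] a0 Su.
by rewrite -[u]scale1r -(mulVf a0) -scalerA; exact: SZ.
Qed.

Lemma span_submod_closed X : GRing.submod_closed [in span X].
Proof.
apply/submod_closedP; split.
- by exists 0%N, (fun=> 0), (fun=> 0); split; [case|rewrite big_ord0].
- move=> _ _ [m [c [v [Xv ->]]]] [n [d [w [Xw ->]]]].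
  exists (m + n)%N,
    (fun i => match fintype.split i with inl j => c j | inr j => d j end),
    (fun i => match fintype.split i with inl j => v j | inr j => w j end).
  split.
    by move=> i; case: (fintype.split i).
  rewrite big_split_ord /=; congr (_ + _); apply: eq_bigr => i _.
    by rewrite (unsplitK (inl i)).
  by rewrite (unsplitK (inr i)).
- move=> a _ [m [c [v [Xv ->]]]]; exists m, (fun i => a * c i), v; split=> //.
  by rewrite scaler_sumr; apply: eq_bigr => i _; rewrite scalerA.
Qed.

Lemma sub_span X : X `<=` span X.
Proof.
move=> x Xx; exists 1%N, (fun=> 1), (fun=> x).
by rewrite big_ord1 scale1r.
Qed.

Lemma span_sub X S : GRing.submod_closed [in S] -> X `<=` S -> span X `<=` S.
Proof.
move=> /submod_closedP[S0 SD SZ] XS _ [n [c [v [Xv ->]]]].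
by apply: big_ind => // i _; apply: SZ; exact: XS.
Qed.

End Span.

Lemma span_linear_sub (K : numFieldType) (V W : lmodType K) (X : set V)
  (S : set W) (f : V -> W) :
  GRing.submod_closed [in S] -> linear f -> (forall x, X x -> S (f x)) ->
  forall x, span X x -> S (f x).
Proof.
move=> /submod_closedP[S0 SD SZ] fl XS.
have f0 : f 0 = 0.
  by rewrite -[X in f X](addNr 0) -scaleN1r fl scaleN1r addNr.
apply: (@span_sub _ _ X [set x | S (f x)]) => //.
apply/submod_closedP; split=> [|u v /= Su Sv|a u /= Su].
- by rewrite /= f0.
- by rewrite -[u]scale1r fl scale1r; exact: SD.
- by rewrite -[_ *: _]addr0 fl f0 addr0; exact: SZ.
Qed.

Section BoundedOperators.
Variables (K : numFieldType) (V : normedModType K).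
Implicit Types (f g : boundedOp V) (S X : set (boundedOp V)).

Lemma boundedOp_is_linear f : linear f.
Proof. by have /bounded_operatorP[] := boundedOpP f. Qed.

HB.instance Definition _ f :=
  GRing.isLinear.Build K V V *:%R f (boundedOp_is_linear f).

Lemma boundedOp_scaleAl a f g : a *: (f * g) = (a *: f) * g.
Proof. exact: boundedOp_ext. Qed.

Lemma boundedOp_scaleAr a f g : a *: (f * g) = f * (a *: g).
Proof. by apply: boundedOp_ext => x /=; rewrite linearZ. Qed.

Lemma boundedOp_mull_linear f : linear (fun g => f * g).
Proof. by move=> a g h; rewrite mulrDr boundedOp_scaleAr. Qed.

Lemma boundedOp_mulr_linear f : linear (fun g => g * f).
Proof. by move=> a g h; rewrite mulrDl boundedOp_scaleAl. Qed.

Lemma lie_linearl f : linear (fun g => lie g f).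
Proof.
move=> a g h; rewrite /lie boundedOp_mull_linear boundedOp_mulr_linear.
by rewrite scalerBr opprD addrACA.
Qed.

Lemma lie_linearr f : linear (lie f).
Proof.
move=> a g h; rewrite /lie boundedOp_mull_linear boundedOp_mulr_linear.
by rewrite scalerBr opprD addrACA.
Qed.

Lemma boundedOp_eq_dense (D : set V) f g : closure (span D) = setT ->
  {in D, f =1 g} -> f = g.
Proof.
move=> Ddense fg; apply: boundedOp_ext => x.
have spanE y : span D y -> f y = g y.
  move=> [n [c [v [Dv ->]]]]; rewrite !linear_sum; apply: eq_bigr => i _.
  by rewrite !linearZ /= fg //; apply/mem_set.
have /bounded_operatorP[hl [M M0 hM]] := boundedOpP (f - g).
apply/eqP; rewrite -subr_eq0 -normr_le0; apply/ler_addgt0Pl => e e0.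
rewrite addr0.
have M1 : 0 < M + 1 by rewrite ltr_wpDl.
have : closure (span D) x by rewrite Ddense.
move=> /(_ (ball x (e / (M + 1)))) [].
  by apply: nbhsx_ballx; rewrite divr_gt0.
move=> y [/spanE yE]; rewrite -ball_normE /ball_ /= => xy.
have -> : f x - g x = (f - g) (x - y).
  transitivity (f (x - y) - g (x - y)) => //.
  by rewrite !linearB /= yE opprK [- _ + _]addrC addrA subrK.
rewrite (le_trans (hM _))// (@le_trans _ _ ((M + 1) * `|x - y|))//.
  by rewrite ler_wpM2r// lerDl.
by rewrite mulrC -ler_pdivlMr// ltW.
Qed.

Lemma generated_subalgebra_closed X :
  unital_subalgebra (generated_subalgebra X).
Proof.
split.
- by apply/mem_set => S [[/set_mem]].
- move=> a f g /set_mem Gf /set_mem Gg; apply/mem_set => S XS.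
  case: (XS) => -[_ SL _] _; apply/set_mem/SL; apply/mem_set.
    exact: Gf.
  exact: Gg.
- move=> f g /set_mem Gf /set_mem Gg; apply/mem_set => S XS.
  case: (XS) => -[_ _ SM] _; apply/set_mem/SM; apply/mem_set.
    exact: Gf.
  exact: Gg.
Qed.

Lemma unital_subalgebra_submod S :
  unital_subalgebra S -> GRing.submod_closed [in S].
Proof.
move=> [S1 SL _]; split=> //.
by rewrite -(subrr 1) addrC -scaleN1r; exact: SL.
Qed.

Lemma unital_subalgebraM S f g : unital_subalgebra S ->
  S f -> S g -> S (f * g).
Proof. by move=> [_ _ SM] /mem_set Sf /mem_set Sg; exact/set_mem/SM. Qed.

Lemma unital_subalgebraX S f n : unital_subalgebra S -> S f -> S (f ^+ n).
Proof.
move=> SA Sf; elim: n => [|n IHn]; first by case: SA => /set_mem.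
by rewrite exprS; exact: unital_subalgebraM.
Qed.

Lemma idealizer_unital_subalgebra S : GRing.submod_closed [in S] ->
  unital_subalgebra [set x | forall y, S y -> S (x * y) /\ S (y * x)].
Proof.
move=> /submod_closedP[S0 SD SZ]; split.
- by apply/mem_set => y Sy; rewrite mul1r mulr1.
- move=> a f g /set_mem If /set_mem Ig; apply/mem_set => y Sy.
  rewrite mulrDl mulrDr -boundedOp_scaleAl -boundedOp_scaleAr.
  have [? ?] := If _ Sy; have [? ?] := Ig _ Sy.
  by split; apply: SD => //; exact: SZ.
- move=> f g /set_mem If /set_mem Ig; apply/mem_set => y Sy.
  split; first by rewrite -mulrA; apply: (If _ _).1; apply: (Ig _ _).1.
  by rewrite mulrA; apply: (Ig _ _).2; apply: (If _ _).2.
Qed.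

End BoundedOperators.

Section QHeisenberg.
Variables (K : numFieldType) (V : normedModType K) (A B : boundedOp V) (q : K).
Hypotheses (q_neq0 : q != 0) (q_expn_neq1 : forall n, q ^+ n.+1 != 1).
Hypothesis AB_rel : A * B = q *: (B * A) + 1.

(* [C] is a variable so that the distributivity rewrites below do not unfold
   it to [A * B - B * A]. *)
Variable C : boundedOp V.
Hypothesis CE : C = lie A B.

Let q1_neq0 : 1 - q != 0.
Proof. by rewrite subr_eq0 eq_sym -[q]expr1. Qed.

Lemma mulBA : B * A = (1 - q)^-1 *: (1 - C).
Proof.
apply: (scalerI q1_neq0); rewrite scalerA mulfV // scale1r CE /lie AB_rel.
by rewrite opprB addrCA [q *: (B * A) + 1]addrC opprD addNKr scalerBl scale1r.
Qed.

Lemma mulAB : A * B = (1 - q)^-1 *: (1 - q *: C).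
Proof.
have -> : A * B = C + B * A by rewrite CE /lie subrK.
apply: (scalerI q1_neq0); rewrite scalerDr mulBA !scalerA mulfV // !scale1r.
by rewrite scalerBl scale1r addrC addrA subrK.
Qed.

Lemma mulAC : A * C = q *: (C * A).
Proof.
have E : A - q *: (C * A) = (1 - q) *: (A * B * A).
  rewrite mulAB -boundedOp_scaleAl scalerA mulfV // scale1r mulrBl mul1r.
  by rewrite -boundedOp_scaleAl.
have F : A - A * C = (1 - q) *: (A * B * A).
  rewrite -mulrA mulBA -boundedOp_scaleAr scalerA mulfV // scale1r.
  by rewrite mulrBr mulr1.
by apply/oppr_inj/(addrI A); rewrite F -E.
Qed.

Lemma mulCB : C * B = q *: (B * C).
Proof.
have E : B - q *: (B * C) = (1 - q) *: (B * A * B).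
  rewrite -mulrA mulAB -boundedOp_scaleAr scalerA mulfV // scale1r.
  by rewrite mulrBr mulr1 -boundedOp_scaleAr.
have F : B - C * B = (1 - q) *: (B * A * B).
  by rewrite mulBA -boundedOp_scaleAl scalerA mulfV // scale1r mulrBl mul1r.
by apply/oppr_inj/(addrI B); rewrite F -E.
Qed.

Lemma mulACX k : A * C ^+ k = q ^+ k *: (C ^+ k * A).
Proof.
elim: k => [|k IHk]; first by rewrite !expr0 scale1r mul1r mulr1.
rewrite exprSr mulrA IHk -boundedOp_scaleAl -mulrA mulAC -boundedOp_scaleAr.
by rewrite scalerA mulrA -!exprSr.
Qed.

Lemma mulCXB k : C ^+ k * B = q ^+ k *: (B * C ^+ k).
Proof.
elim: k => [|k IHk]; first by rewrite !expr0 scale1r mul1r mulr1.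
rewrite exprS -mulrA IHk -boundedOp_scaleAr mulrA mulCB -boundedOp_scaleAl.
by rewrite scalerA -exprSr -mulrA -exprS.
Qed.

Lemma mulBCX k : B * C ^+ k = q ^- k *: (C ^+ k * B).
Proof. by rewrite mulCXB scalerA mulVf ?scale1r // expf_neq0. Qed.

Lemma mulCXA k : C ^+ k * A = q ^- k *: (A * C ^+ k).
Proof. by rewrite mulACX scalerA mulVf ?scale1r // expf_neq0. Qed.

Lemma mulAXC l : A ^+ l * C = q ^+ l *: (C * A ^+ l).
Proof.
elim: l => [|l IHl]; first by rewrite !expr0 scale1r mul1r mulr1.
rewrite exprS -mulrA IHl -boundedOp_scaleAr mulrA mulAC -boundedOp_scaleAl.
by rewrite scalerA -exprSr -mulrA -exprS.
Qed.

Lemma mulCBX l : C * B ^+ l = q ^+ l *: (B ^+ l * C).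
Proof.
elim: l => [|l IHl]; first by rewrite !expr0 scale1r mul1r mulr1.
rewrite exprSr mulrA IHl -boundedOp_scaleAl -mulrA mulCB -boundedOp_scaleAr.
by rewrite scalerA mulrA -!exprSr.
Qed.

Definition C_ideal_generators : set (boundedOp V) :=
  [set f | exists k l, f = C ^+ k.+1 * A ^+ l \/ f = B ^+ l * C ^+ k.+1].

Definition C_ideal := span C_ideal_generators.

Let IZ : forall a u, C_ideal u -> C_ideal (a *: u).
Proof. by have /submod_closedP[] := span_submod_closed C_ideal_generators. Qed.

Let IB : forall u v, C_ideal u -> C_ideal v -> C_ideal (u - v).
Proof. by move=> u v; apply: submod_closedB (span_submod_closed _). Qed.

Lemma C_idealCA k l : C_ideal (C ^+ k.+1 * A ^+ l).
Proof. by apply: sub_span; exists k, l; left. Qed.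

Lemma C_idealBC k l : C_ideal (B ^+ l * C ^+ k.+1).
Proof. by apply: sub_span; exists k, l; right. Qed.

Lemma C_idealC k : C_ideal (C ^+ k.+1).
Proof. by rewrite -[_ ^+ _]mulr1; exact: (C_idealCA k 0). Qed.

Lemma C_idealAl x : C_ideal x -> C_ideal (A * x).
Proof.
apply: span_linear_sub.
- exact: span_submod_closed.
- exact: boundedOp_mull_linear.
move=> _ [k [l [->|->]]] /=.
  rewrite mulrA mulACX -boundedOp_scaleAl -mulrA -exprS.
  by apply: IZ; exact: C_idealCA.
case: l => [|l].
  by rewrite mul1r mulACX; apply: IZ; rewrite -[A]expr1; exact: C_idealCA.
rewrite exprS !mulrA mulAB -!boundedOp_scaleAl !mulrBl mul1r.
rewrite -!boundedOp_scaleAl mulCBX -boundedOp_scaleAl -[_ * C * _]mulrA -exprS.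
by apply: IZ; apply: IB; [|do 2! apply: IZ]; exact: C_idealBC.
Qed.

Lemma C_idealAr x : C_ideal x -> C_ideal (x * A).
Proof.
apply: (span_linear_sub (X := C_ideal_generators) (f := fun x => x * A)).
- exact: span_submod_closed.
- exact: boundedOp_mulr_linear.
move=> _ [k [l [->|->]]] /=.
  by rewrite -mulrA -exprSr; exact: C_idealCA.
case: l => [|l].
  by rewrite mul1r -[A in _ * A]expr1; exact: C_idealCA.
rewrite -mulrA mulCXA -boundedOp_scaleAr [B ^+ _]exprSr mulrA.
rewrite -[_ * B * A]mulrA mulBA -boundedOp_scaleAr -boundedOp_scaleAl mulrBr mulr1 mulrBl.
rewrite -[_ * C * _]mulrA -exprS.
by do 2! apply: IZ; apply: IB; exact: C_idealBC.
Qed.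

Lemma C_idealBl x : C_ideal x -> C_ideal (B * x).
Proof.
apply: span_linear_sub.
- exact: span_submod_closed.
- exact: boundedOp_mull_linear.
move=> _ [k [l [->|->]]] /=; last first.
  by rewrite mulrA -exprS; exact: C_idealBC.
case: l => [|l].
  by rewrite mulr1 -[B in B * _]expr1; exact: C_idealBC.
rewrite mulrA mulBCX -boundedOp_scaleAl [A ^+ _]exprS mulrA.
rewrite -[_ * B * A]mulrA mulBA -boundedOp_scaleAr -boundedOp_scaleAl mulrBr mulr1 mulrBl -exprSr.
by do 2! apply: IZ; apply: IB; exact: C_idealCA.
Qed.

Lemma C_idealBr x : C_ideal x -> C_ideal (x * B).
Proof.
apply: (span_linear_sub (X := C_ideal_generators) (f := fun x => x * B)).
- exact: span_submod_closed.
- exact: boundedOp_mulr_linear.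
move=> _ [k [l [->|->]]] /=; last first.
  rewrite -mulrA mulCXB -boundedOp_scaleAr mulrA -exprSr.
  by apply: IZ; exact: C_idealBC.
case: l => [|l].
  rewrite mulr1 mulCXB; apply: IZ.
  by rewrite -[B in B * _]expr1; exact: C_idealBC.
rewrite [A ^+ _]exprSr -!mulrA mulAB -!boundedOp_scaleAr !mulrBr mulr1.
rewrite -!boundedOp_scaleAr mulAXC -boundedOp_scaleAr mulrA -exprSr.
by apply: IZ; apply: IB; [|do 2! apply: IZ]; exact: C_idealCA.
Qed.

Lemma generated_subalgebra_idealizes x y :
  generated_subalgebra [set A; B] x -> C_ideal y ->
  C_ideal (x * y) /\ C_ideal (y * x).
Proof.
move=> Gx; move: y.
apply: (Gx [set x | forall y, C_ideal y -> C_ideal (x * y) /\ C_ideal (y * x)]).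
split.
  exact/idealizer_unital_subalgebra/span_submod_closed.
by move=> _ [->|->] y Iy; split;
  [exact: C_idealAl|exact: C_idealAr|exact: C_idealBl|exact: C_idealBr].
Qed.

Lemma C_ideal_sub_L0 : C_ideal `<=` L0 A B.
Proof.
apply: span_sub; first exact: span_submod_closed.
rewrite /C_ideal_generators CE => f [k [l fE]]; apply: sub_span; apply: Or33.
case: l fE => [|l] fE.
  exists k.+1, 1%N; split=> //; apply: Or31.
  by case: fE => ->; rewrite ?mulr1 ?mul1r.
by exists k.+1, l.+1; split=> //; case: fE => ->; [apply: Or32|apply: Or33].
Qed.

Lemma L0_generatorsP f : L0_generators A B f -> [\/ f = A, f = B | C_ideal f].
Proof.
rewrite /L0_generators -CE.
move=> [->|->|[[|k] [l [k_gt0 _ fE]]]]; [exact: Or31|exact: Or32|by []|].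
apply: Or33.
case: fE => ->; [exact: C_idealC|exact: C_idealCA|exact: C_idealBC].
Qed.

Lemma lie_C_ideal x y : generated_subalgebra [set A; B] x -> C_ideal y ->
  C_ideal (lie x y) /\ C_ideal (lie y x).
Proof.
move=> Gx Iy; have [? ?] := generated_subalgebra_idealizes Gx Iy.
by split; exact: IB.
Qed.

Lemma L0_sub_generated_subalgebra :
  L0 A B `<=` generated_subalgebra [set A; B].
Proof.
have GA := generated_subalgebra_closed [set A; B].
have Gsub := unital_subalgebra_submod GA.
have AG : generated_subalgebra [set A; B] A.
  by move=> S [_]; apply; left.
have BG : generated_subalgebra [set A; B] B.
  by move=> S [_]; apply; right.
have CG : generated_subalgebra [set A; B] C.
  by rewrite CE; apply: (submod_closedB Gsub); exact: (unital_subalgebraM GA).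
rewrite /L0 /L0_generators -CE.
apply: span_sub => // _ [->|->|[k [l [_ _ [->|->|->]]]]] //.
- exact: (unital_subalgebraX _ GA).
- by apply: (unital_subalgebraM GA); exact: (unital_subalgebraX _ GA).
- by apply: (unital_subalgebraM GA); exact: (unital_subalgebraX _ GA).
Qed.

Lemma L0_lie_subalgebra :
  lie_subalgebra (generated_subalgebra [set A; B]) (L0 A B).
Proof.
split; [exact: L0_sub_generated_subalgebra|exact: span_submod_closed|].
move=> f g Lf Lg; apply: C_ideal_sub_L0; move: f Lf.
apply: (@span_linear_sub _ _ _ (L0_generators A B) C_ideal
  (fun f => lie f g)) => [||f Xf].
- exact: span_submod_closed.
- exact: lie_linearl.
move: g Lg; apply: span_linear_sub => [||g Xg].
- exact: span_submod_closed.
- exact: lie_linearr.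
have I0 : C_ideal 0.
  by have /submod_closedP[] := span_submod_closed C_ideal_generators.
have Gf := L0_sub_generated_subalgebra (sub_span Xf).
have Gg := L0_sub_generated_subalgebra (sub_span Xg).
have [fE|fE|If] := L0_generatorsP Xf; last exact: (lie_C_ideal Gg If).2.
all: have [gE|gE|Ig] := L0_generatorsP Xg; last exact: (lie_C_ideal Gf Ig).1.
- by rewrite fE gE /lie subrr.
- by rewrite fE gE -CE; exact: (C_idealC 0).
- rewrite fE gE /lie -opprB -/(lie A B) -CE -scaleN1r.
  by apply: IZ; exact: (C_idealC 0).
- by rewrite fE gE /lie subrr.
Qed.

Section Generation.
Variable S : set (boundedOp V).
Hypotheses (S_lie : lie_subalgebra (generated_subalgebra [set A; B]) S)
  (SA : S A) (SB : S B).

Let S_sub : GRing.submod_closed [in S].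
Proof. by case: S_lie. Qed.

Let SL f g : S f -> S g -> S (lie f g).
Proof. by case: S_lie => _ _; apply. Qed.

Lemma lie_subalgebraCA k : S (C ^+ k.+1) -> forall l, S (C ^+ k.+1 * A ^+ l).
Proof.
move=> SC; elim=> [|l IHl]; first by rewrite mulr1.
apply: (@submod_closed_scaleI _ _ _ (1 - q ^+ k.+1)) => //.
  by rewrite subr_eq0 eq_sym.
have := SL IHl SA; rewrite /lie [A * _]mulrA mulACX -boundedOp_scaleAl -!mulrA.
by rewrite -exprS -exprSr scalerBl scale1r.
Qed.

Lemma lie_subalgebraBC k : S (C ^+ k.+1) -> forall l, S (B ^+ l * C ^+ k.+1).
Proof.
move=> SC; elim=> [|l IHl]; first by rewrite mul1r.
apply: (@submod_closed_scaleI _ _ _ (1 - q ^+ k.+1)) => //.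
  by rewrite subr_eq0 eq_sym.
have := SL SB IHl; rewrite /lie -[_ * _ * B]mulrA mulCXB -boundedOp_scaleAr.
by rewrite !mulrA -exprS -exprSr scalerBl scale1r.
Qed.

Lemma lie_subalgebraC k : S (C ^+ k.+1).
Proof.
elim: k => [|k IHk]; first by rewrite CE; exact: SL.
have := SL (lie_subalgebraCA IHk 1) SB.
rewrite expr1 /lie [B * _]mulrA mulBCX -boundedOp_scaleAl -!mulrA.
rewrite mulAB mulBA -!boundedOp_scaleAr !mulrBr !mulr1 -boundedOp_scaleAr.
rewrite -exprSr; set p := C ^+ k.+1; set r := C ^+ k.+2; set c := (1 - q)^-1.
set d := q ^- k.+1 => Sx.
have /submod_closedP[_ _ SZ] := S_sub.
apply: (@submod_closed_scaleI _ _ _ (c * (d - q))) => //.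
  rewrite mulf_neq0 ?invr_neq0 // subr_eq0; apply/eqP => dq.
  have := q_expn_neq1 k.+1.
  by rewrite exprS -{1}dq mulVf ?eqxx // expf_neq0.
have -> : (c * (d - q)) *: r =
    c *: (p - q *: r) - d *: (c *: (p - r)) - (c * (1 - d)) *: p.
  rewrite !scalerBr !scalerA !mulrBr !scalerBl mulr1 [d * c]mulrC; apply/esym.
  by rewrite !opprB !addrA subrK addrC !addrA addNr add0r addrC.
by apply: (submod_closedB S_sub) => //; exact: SZ.
Qed.

Lemma L0_sub_lie_subalgebra : L0 A B `<=` S.
Proof.
rewrite /L0 /L0_generators -CE.
apply: span_sub => // _ [->|->|[[|k] [l [k_gt0 _ [->|->|->]]]]] //.
- exact: lie_subalgebraC.
- exact/lie_subalgebraCA/lie_subalgebraC.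
- exact/lie_subalgebraBC/lie_subalgebraC.
Qed.

End Generation.

Lemma lie_polynomials_L0 : lie_polynomials A B = L0 A B.
Proof.
apply/seteqP; split=> f.
  move=> Lf; apply: Lf; split; first exact: L0_lie_subalgebra.
  by move=> _ [->|->]; apply: sub_span; [apply: Or31|apply: Or32].
by move=> Lf S [SL SAB]; apply: L0_sub_lie_subalgebra Lf => //;
  apply: SAB; [left|right].
Qed.

End QHeisenberg.

Theorem theorem4p3 (R : realType) (q : R) (q_gt0 : 0 < q) (q_lt1 : q < 1)
  (H : completeNormedModType R[i]) (dot : {dot H for conjC})
  (dot_norm : forall x : H, dot x x = `|x| ^+ 2)
  (Phi : nat -> H) (Phi_basis : complete_orthonormal_basis dot Phi)
  (A B : boundedOp H)
  (B_Phi : forall n : nat, B (Phi n) = (Num.sqrt (qint q n.+1))%:C *: Phi n.+1)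
  (A_Phi : forall n : nat, (0 < n)%N ->
    A (Phi n) = (Num.sqrt (qint q n))%:C *: Phi n.-1)
  (A_Phi0 : A (Phi 0%N) = 0) :
  lie_polynomials A B = L0 A B.
Proof.
have qint_ge0 n : 0 <= qint q n.
  by apply: sumr_ge0 => i _; rewrite exprn_ge0 // ltW.
have qintS n : qint q n.+1 = q * qint q n + 1.
  rewrite /qint big_ord_recl expr0 addrC mulr_sumr; congr (_ + _).
  by apply: eq_bigr => i _; rewrite exprS.
have BA_Phi n : B (A (Phi n)) = (qint q n)%:C *: Phi n.
  case: n => [|n]; first by rewrite A_Phi0 linear0 /qint big_ord0 scale0r.
  by rewrite A_Phi // linearZ /= B_Phi scalerA -rmorphM -expr2 sqr_sqrtr.
have AB_Phi n : A (B (Phi n)) = (qint q n.+1)%:C *: Phi n.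
  by rewrite B_Phi linearZ /= A_Phi // scalerA -rmorphM -expr2 sqr_sqrtr.
apply: (@lie_polynomials_L0 _ _ A B q%:C _ _ _ (lie A B)) => //.
- by rewrite (fmorph_eq0 (real_complex R)) gt_eqF.
- move=> n; rewrite -rmorphXn (fmorph_eq1 (real_complex R)) lt_eqF //.
  by rewrite exprn_ilt1 // ltW.
apply: (@boundedOp_eq_dense _ _ (range Phi)); first by case: Phi_basis.
move=> _ /set_mem[n _ <-].
transitivity (q%:C *: B (A (Phi n)) + Phi n) => //.
rewrite [LHS]AB_Phi qintS rmorphD rmorphM rmorph1 scalerDl scale1r -scalerA.
by rewrite BA_Phi.
Qed.
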